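(* Let $(A_{m,n})_{m,n\in\mathbb N}$ be an infinite complex matrix such that there exist $\gamma_0\ge0$ and $C_0>0$, and for every $\gamma>0$ there is $C_\gamma>0$, so that $$|A_{m,n}|\le \begin{cases} C_0\, n^{\gamma_0}, & n>m,\\ C_\gamma\, n^{\gamma}m^{-\gamma}, & n\le m,\end{cases}\qquad m,n\in\mathbb N.$$ Then $\mathcal A$ is a continuous operator from $\mathbf s$ into $\mathbf s$.
   Context: $\mathbb N=\{1,2,\dots\}$. For a matrix $(A_{m,n})_{m,n\in\mathbb N}$, $\mathcal A$ denotes the linear map $(c_n)_{n=1}^\infty\mapsto (a_m)_{m=1}^\infty$ with $a_m=\sum_{n=1}^\infty A_{m,n}c_n$; saying that $\mathcal A$ is a continuous operator from one sequence space into another includes the assertion that these series converge for all sequences in the domain. $\mathbf s$ is the Fréchet space of rapidly decreasing complex sequences, i.e. the sequences $(a_n)_{n=1}^\infty$ with $\sup_{n\in\mathbb N}|a_n|n^k<\infty$ for all $k\in\mathbb N_0=\mathbb N\cup\{0\}$, topologized by these norms. *)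

(* Defs.v *)
From HB Require Import structures.
From mathcomp Require Import all_boot all_order all_algebra.
From mathcomp Require Import all_classical all_reals all_analysis.
From mathcomp Require Import complex.
Set Implicit Arguments.
Unset Strict Implicit.
Unset Printing Implicit Defensive.
Import Order.TTheory GRing.Theory Num.Theory.
Import numFieldNormedType.Exports.
Export numFieldNormedType.Exports.
Export ComplexField.Normc.
Local Open Scope classical_set_scope.
Local Open Scope ring_scope.

(* Sequences and matrices indexed by {1, 2, ...} are functions on nat: the
   index i : nat stands for the integer i.+1, and weights are written with
   i.+1 accordingly.  The modulus of z : R[i] is the real number normc z.
   R[i]^o is R[i] seen as a normed space over itself. *)

(* The terms of which p_k(a) = sup_n |a_n| n^k is the supremum. *)
Definition weighted (R : realType) (a : nat -> R[i]^o) (k n : nat) : R :=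
  normc (a n) * n.+1%:R ^+ k.

Definition rapidly_decreasing (R : realType) : pred (nat -> R[i]^o) :=
  fun a => `[< forall k, has_ubound (range (weighted a k)) >].

Record rdseq (R : realType) := RdSeq {
  rdval :> nat -> R[i]^o;
  _ : rdval \in @rapidly_decreasing R }.

HB.instance Definition _ (R : realType) := [isSub for @rdval R].
HB.instance Definition _ (R : realType) := [Choice of rdseq R by <:].

Lemma weightedD (R : realType) (a b : nat -> R[i]^o) k n :
  weighted (a + b) k n <= weighted a k n + weighted b k n.
Proof. by rewrite -mulrDl ler_wpM2r ?exprn_ge0// le_normcD. Qed.

Lemma weightedZ (R : realType) (c : R[i]) (a : nat -> R[i]^o) k n :
  weighted (c *: a) k n = normc c * weighted a k n.
Proof. by rewrite mulrA -normcM. Qed.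

Lemma rapidly_decreasing_submod (R : realType) :
  submod_closed (@rapidly_decreasing R).
Proof.
split=> [|c a b /asboolP ha /asboolP hb].
  apply/asboolP => k; exists 0 => _ [n _ <-].
  by rewrite /weighted normc0 mul0r.
apply/asboolP => k; have [M hM] := ha k; have [N hN] := hb k.
have c0 : 0 <= normc c by case: (c) => x y; rewrite sqrtr_ge0.
exists (normc c * M + N) => _ [n _ <-].
rewrite (le_trans (weightedD _ _ _ _))// weightedZ lerD//.
  by rewrite ler_wpM2l// hM//; exists n.
by apply: hN; exists n.
Qed.

HB.instance Definition _ (R : realType) :=
  GRing.isSubmodClosed.Build R[i] (nat -> R[i]^o) (@rapidly_decreasing R)
    (@rapidly_decreasing_submod R).
HB.instance Definition _ (R : realType) :=
  [SubChoice_isSubLmodule of rdseq R by <:].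

Definition rdnorm (R : realType) (k : nat) (a : rdseq R) : R :=
  sup (range (weighted a k)).

Definition rdball (R : realType) (a : rdseq R) (K : nat) (e : R) :
    set (rdseq R) :=
  [set b | forall k, (k <= K)%N -> rdnorm k (b - a) < e].

Definition rdnbhs (R : realType) (a : rdseq R) : set_system (rdseq R) :=
  [set U | exists K e, 0 < e /\ rdball a K e `<=` U].

HB.instance Definition _ (R : realType) := hasNbhs.Build (rdseq R) (@rdnbhs R).

Lemma rdval_has_ubound (R : realType) (a : rdseq R) k :
  has_ubound (range (weighted a k)).
Proof. by case: a => a ra /=; move/asboolP: ra; exact. Qed.

Lemma rdnormD (R : realType) k (a b : rdseq R) :
  rdnorm k (a + b) <= rdnorm k a + rdnorm k b.
Proof.
apply: ge_sup; first by exists (weighted (a + b) k 0), 0%N.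
move=> _ [n _ <-]; rewrite (le_trans (weightedD _ _ _ _))//.
by apply: lerD; (apply: ub_le_sup; [exact: rdval_has_ubound | exists n]).
Qed.

Lemma rdnorm0 (R : realType) k : rdnorm k (0 : rdseq R) = 0.
Proof.
rewrite /rdnorm (_ : range _ = [set 0]) ?sup1// predeqE => x; split.
  by case=> n _ <-; rewrite /weighted normc0 mul0r.
by move=> /= ->; exists 0%N => //; rewrite /weighted normc0 mul0r.
Qed.

Lemma rdball_center (R : realType) (a : rdseq R) (K : nat) (e : R) : 0 < e -> rdball a K e a.
Proof. by move=> e0 k _; rewrite subrr rdnorm0. Qed.
Arguments rdball_center {R} a K {e}.

Lemma rdnbhs_filter (R : realType) (a : rdseq R) : ProperFilter (nbhs a).
Proof.
split; first by case=> K [e [e0 /(_ a (rdball_center a K e0))]].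
split; first by exists 0%N, 1.
  move=> U V [K [e [e0 hU]]] [L [d [d0 hV]]].
  exists (maxn K L), (Num.min e d); split; first by rewrite lt_min e0.
  move=> b hb; split; [apply: hU|apply: hV] => k kle;
    have := hb k; rewrite leq_max kle ?orbT lt_min => /(_ isT) /andP[]//.
by move=> U V UV [K [e [e0 hU]]]; exists K, e; split=> // b /hU /UV.
Qed.

Lemma rdnbhs_singleton (R : realType) (a : rdseq R) (U : set (rdseq R)) :
  nbhs a U -> U a.
Proof. by case=> K [e [e0]]; apply; exact: rdball_center. Qed.

Lemma rdnbhs_nbhs (R : realType) (a : rdseq R) (U : set (rdseq R)) :
  nbhs a U -> nbhs a (nbhs^~ U).
Proof.
move=> [K [e [e0 hU]]]; exists K, (e / 2); split; first by rewrite divr_gt0.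
move=> b hb; exists K, (e / 2); split; first by rewrite divr_gt0.
move=> c hc; apply: hU => k kK.
have -> : c - a = (c - b) + (b - a) by rewrite addrA subrK.
by rewrite (le_lt_trans (rdnormD _ _ _))// (splitr e) ltrD ?hc ?hb.
Qed.

HB.instance Definition _ (R : realType) :=
  Nbhs_isNbhsTopological.Build (rdseq R)
    (@rdnbhs_filter R) (@rdnbhs_singleton R) (@rdnbhs_nbhs R).

Definition matrix_term (R : realType) (A : nat -> nat -> R[i])
  (c : nat -> R[i]^o) (m : nat) : nat -> R[i]^o := fun n => A m n * c n.

Definition matrix_map (R : realType) (A : nat -> nat -> R[i])
    (c : nat -> R[i]^o) : nat -> R[i]^o :=
  fun m => limn (series (matrix_term A c m)).

(* limn is a junk value on divergent series, so convergence is required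
   separately.  The last clause says that matrix_map A maps rdseq R into
   itself, linearly and continuously. *)
Definition continuous_operator (R : realType) (A : nat -> nat -> R[i]) : Prop :=
  (forall (c : rdseq R) m, cvgn (series (matrix_term A c m))) /\
  exists2 T : {linear rdseq R -> rdseq R},
    (forall c : rdseq R, rdval (T c) = matrix_map A c) & continuous T.

(* Main.v *)
(* Taking gamma = k + 1 when n <= m, and m^k <= n^k when n > m, the hypothesis
   gives |A_(m,n)| m^k <= B n^L for every k, with L and B depending on k only.
   Hence |A_(m,n) c_n| m^k <= B p_(L+2)(c) n^(-2), where p_j is the j-th norm of
   s; summing over n, the series converge absolutely and
   p_k(A c) <= 2 B p_(L+2)(c). *)

From HB Require Import structures.
Require Import Defs.
From mathcomp Require Import all_boot all_order all_algebra.
From mathcomp Require Import all_classical all_reals all_analysis.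
From mathcomp Require Import complex.
From mathcomp Require Import ring lra.
Set Implicit Arguments.
Unset Strict Implicit.
Unset Printing Implicit Defensive.
Import Order.TTheory GRing.Theory Num.Theory.
Local Open Scope ring_scope.

Lemma normcE (R : rcfType) (z : R[i]) : `|z| = (normc z)%:C%C.
Proof. by case: z. Qed.

Lemma normc_ge0 (R : rcfType) (z : R[i]) : 0 <= normc z.
Proof. by case: z => x y; exact: sqrtr_ge0. Qed.

Lemma normc_sum (R : rcfType) (I : Type) (r : seq I) (F : I -> R[i]) :
  normc (\sum_(i <- r) F i) <= \sum_(i <- r) normc (F i).
Proof.
elim: r => [|i r IH]; first by rewrite !big_nil normc0.
by rewrite !big_cons (le_trans (le_normcD _ _))// lerD2l.
Qed.

Lemma Re_le_normc (R : rcfType) (z : R[i]) : `|complex.Re z| <= normc z.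
Proof. by rewrite -lecR -normcE; exact: complex.normc_ge_Re. Qed.

Lemma Im_le_normc (R : rcfType) (z : R[i]) : `|complex.Im z| <= normc z.
Proof.
case: z => x y /=; rewrite -sqrtr_sqr ler_wsqrtr//.
by rewrite lerDr sqr_ge0.
Qed.

Lemma cvg_real_complex (R : realType) (u : nat -> R) (l : R) :
  (u n @[n --> \oo] --> l)%classic ->
  (((u n)%:C%C : R[i]^o) @[n --> \oo] --> (l%:C%C : R[i]^o))%classic.
Proof.
(* Radii in [R[i]^o] are themselves complex: [0 < e +i* e'] forces [e' = 0] and [0 < e], so the test
   reduces to real radii. *)
move=> /cvgrPdist_lt ul; apply/cvgrPdist_lt => -[e e']; rewrite ltcE /=.
move=> /andP[/eqP -> e0]; near=> n.
rewrite -[(e +i* 0)%C]/(e%:C)%C -rmorphB/= normcE ltcR/=.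
rewrite expr0n/= addr0 sqrtr_sqr.
by near: n; exact: ul.
Unshelve. all: end_near. Qed.

Lemma cvg_complex (R : realType) (u : nat -> R[i]^o) :
  cvgn (fun n => complex.Re (u n)) -> cvgn (fun n => complex.Im (u n)) ->
  cvgn u.
Proof.
move=> /cvg_real_complex cr /cvg_real_complex ci.
have -> : u = (fun n => (complex.Re (u n))%:C%C : R[i]^o) +
              ('i%C : R[i]) *: (fun n => (complex.Im (u n))%:C%C : R[i]^o).
  by apply/funext => n; rewrite [LHS]complexE.
apply: is_cvgD; first by apply: cvgP cr.
by apply: is_cvgZr; apply: cvgP ci.
Qed.

(** Absolute convergence: the partial sums of [|u n|] are nondecreasing and bounded by [M]. *)
Lemma cvg_series_real_bounded (R : realType) (u v : nat -> R) (M : R) :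
  (forall n, `|u n| <= v n) -> (forall N, \sum_(0 <= n < N) v n <= M) ->
  cvgn (series u).
Proof.
move=> uv vM; apply: normed_cvg; apply: nondecreasing_is_cvgn.
  by apply: nondecreasing_series => *; exact: normr_ge0.
exists M => _ [N _ <-]; apply: le_trans (vM N).
by apply: ler_sum => n _; exact: uv.
Qed.

(** Monotone convergence is a real argument, so it is applied to the real and imaginary parts, both
    dominated by the modulus. *)
Lemma cvg_series_normc_bounded (R : realType) (z : nat -> R[i]^o) (M : R) :
  (forall N, \sum_(0 <= n < N) normc (z n) <= M) -> cvgn (series z).
Proof.
move=> zM; apply: cvg_complex.
  have -> : (fun n => complex.Re (series z n)) = series (@complex.Re R \o z).
    by apply/funext => n; rewrite /series /= raddf_sum.
  by apply: cvg_series_real_bounded zM => n; exact: Re_le_normc.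
have -> : (fun n => complex.Im (series z n)) = series (@complex.Im R \o z).
  by apply/funext => n; rewrite /series /= raddf_sum.
by apply: cvg_series_real_bounded zM => n; exact: Im_le_normc.
Qed.

Lemma normc_lim_series_le (R : realType) (z : nat -> R[i]^o) (M : R) :
  (forall N, \sum_(0 <= n < N) normc (z n) <= M) ->
  normc (limn (series z)) <= M.
Proof.
move=> zM; rewrite leNgt; apply/negP => Ml.
have /cvgrPdist_lt := cvg_series_normc_bounded zM.
set l := limn _ in Ml *.
(* If [M < normc l], this gap is a legitimate radius; a partial sum strictly closer than that to [l]
   would have modulus above [M]. *)
move=> /(_ (normc l - M)%:C%C).
rewrite ltcR subr_gt0 => /(_ Ml) [N _ /(_ N (leqnn N))].
rewrite /= normcE ltcR; apply/negP; rewrite -leNgt.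
have := le_normcD (l - series z N) (series z N).
rewrite subrK => h; rewrite lerBlDr (le_trans h)// lerD2l.
exact: le_trans (normc_sum _ _) (zM N).
Qed.

Lemma sum_inv_sqr_le2 (R : realFieldType) N :
  \sum_(0 <= n < N) (n.+1%:R ^- 2 : R) <= 2.
Proof.
(* The strengthened bound telescopes: with x = N + 1 >= 1, 2/x - 2/(x+1) exceeds 1/x^2 by
   (x-1)/(x^2(x+1)) >= 0. *)
suff: \sum_(0 <= n < N) (n.+1%:R ^- 2 : R) <= 2 - 2 / N.+1%:R.
  by move=> /le_trans; apply; rewrite gerBl divr_ge0.
elim: N => [|N IH]; first by rewrite big_nil divr1 subrr.
rewrite big_nat_recr//= (le_trans (lerD IH (lexx _)))//.
rewrite -addrA lerD2l -[N.+2%:R]natr1.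
have : 1 <= N.+1%:R :> R by rewrite ler1n.
move: N.+1%:R => x x1; rewrite -subr_ge0.
have -> : - (2 / (x + 1)) - (- (2 / x) + x ^- 2) = (x - 1) / (x ^+ 2 * (x + 1)).
  by field; rewrite !gt_eqF//; lra.
by rewrite divr_ge0 ?mulr_ge0 ?sqr_ge0//; lra.
Qed.

Lemma weighted_le_rdnorm (R : realType) (c : rdseq R) k n :
  weighted c k n <= rdnorm k c.
Proof. by apply: ub_le_sup; [exact: rdval_has_ubound | exists n]. Qed.

Lemma rdnorm_ge0 (R : realType) (c : rdseq R) k : 0 <= rdnorm k c.
Proof.
apply: le_trans (weighted_le_rdnorm c k 0).
by rewrite mulr_ge0 ?normc_ge0 ?exprn_ge0.
Qed.

Lemma rdnorm_le_ub (R : realType) (c : rdseq R) k (M : R) :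
  (forall n, weighted c k n <= M) -> rdnorm k c <= M.
Proof.
move=> cM; apply: ge_sup; first by exists (weighted c k 0), 0%N.
by move=> _ [n _ <-].
Qed.

(** The weights [n.+1] are at least 1. Hence the norm of index [K] alone controls every condition
    defining [rdball _ K _]. *)
Lemma rdnorm_le_exp (R : realType) (c : rdseq R) j k :
  (j <= k)%N -> rdnorm j c <= rdnorm k c.
Proof.
move=> jk; apply: rdnorm_le_ub => n; apply: le_trans (weighted_le_rdnorm _ _ n).
by rewrite ler_wpM2l ?normc_ge0// ler_weXn2l// ler1n.
Qed.

Lemma continuous_rdseq_linear (R : realType) (T : {linear rdseq R -> rdseq R}) :
  (forall k, exists L D, forall c, rdnorm k (T c) <= D * rdnorm L c) ->
  continuous T.
Proof.
move=> TD a U [K [e [e0 KU]]]; have [L [D TDL]] := TD K.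
(* [D] has no prescribed sign; [|D| + 1] is a positive constant above it, by which [e] can be
   divided. *)
have D0 : 0 < `|D| + 1 by rewrite ltr_wpDl.
exists L, (e / (`|D| + 1)); split; first by rewrite divr_gt0.
move=> b bL; apply: KU => k kK; rewrite -raddfB.
apply: le_lt_trans (rdnorm_le_exp _ kK) _.
apply: le_lt_trans (TDL _) _; have := bL L (leqnn L).
rewrite ltr_pdivlMr// mulrC; apply: le_lt_trans.
by rewrite ler_wpM2r ?rdnorm_ge0// (le_trans (ler_norm _))// lerDl.
Qed.

Lemma lim_series_linear (K : numFieldType) (V : normedModType K) (a : K)
    (u v : nat -> V) : cvgn (series u) -> cvgn (series v) ->
  limn (series (a *: u + v)) = a *: limn (series u) + limn (series v).
Proof.
move=> cu cv; rewrite seriesD seriesZ; apply: cvg_lim => //.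
by apply: cvgD => //; exact: cvgZr.
Qed.

Section PolynomialGrowth.
Context {R : realType} (A : nat -> nat -> R[i]).
(** The two-case bound on the matrix enters only through this estimate, whose right-hand side is
    independent of [m]. *)
Hypothesis A_growth : forall k, exists L B, forall m n,
  normc (A m n) * m.+1%:R ^+ k <= B * n.+1%:R ^+ L :> R.

(** Uniformity in [N] serves twice: it gives convergence of the series and passes to the limit as a
    bound on its sum. *)
Lemma sum_matrix_term_le k : exists L D, forall (c : rdseq R) m N,
  \sum_(0 <= n < N) normc (matrix_term A c m n) <=
    D * rdnorm L c / m.+1%:R ^+ k.
Proof.
have [L [B AB]] := A_growth k.
(* At indices 0 both weights equal 1, so [B] dominates a modulus. *)
have B0 : 0 <= B.
  have := AB 0%N 0%N; rewrite !expr1n !mulr1; exact/le_trans/normc_ge0.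
(* The two extra powers of n pay for the factor n^(-2), whose sum is at most 2. *)
exists (L + 2)%N, (B * 2) => c m N; rewrite ler_pdivlMr ?exprn_gt0//.
rewrite mulr_suml mulrAC.
apply: le_trans (ler_wpM2l _ (sum_inv_sqr_le2 _ N)); last first.
  by rewrite mulr_ge0// rdnorm_ge0.
rewrite mulr_sumr; apply: ler_sum => n _.
rewrite normcM mulrAC (le_trans (ler_wpM2r (normc_ge0 _) (AB m n)))//.
rewrite -!mulrA ler_wpM2l// ler_pdivlMr ?exprn_gt0//.
apply: le_trans (weighted_le_rdnorm c (L + 2) n).
by rewrite /weighted exprD mulrA [_ * normc _]mulrC.
Qed.

Lemma is_cvg_matrix_term (c : rdseq R) m : cvgn (series (matrix_term A c m)).
Proof.
have [L [D AD]] := sum_matrix_term_le 0.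
exact: cvg_series_normc_bounded (AD c m).
Qed.

Lemma weighted_matrix_map_le k : exists L D, forall (c : rdseq R) m,
  weighted (matrix_map A c) k m <= D * rdnorm L c.
Proof.
have [L [D AD]] := sum_matrix_term_le k.
exists L, D => c m; rewrite -ler_pdivlMr ?exprn_gt0//.
exact: normc_lim_series_le (AD c m).
Qed.

Lemma rapidly_decreasing_matrix_map (c : rdseq R) :
  matrix_map A c \in @rapidly_decreasing R.
Proof.
apply/asboolP => k; have [L [D AD]] := weighted_matrix_map_le k.
by exists (D * rdnorm L c) => _ [m _ <-].
Qed.

Definition rd_matrix_map (c : rdseq R) : rdseq R :=
  RdSeq (rapidly_decreasing_matrix_map c).

Lemma rd_matrix_map_is_linear : linear rd_matrix_map.
Proof.
move=> a c d; apply: val_inj; apply/funext => m /=.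
rewrite /matrix_map.
have -> : matrix_term A (a *: c + d) m =
    a *: matrix_term A c m + matrix_term A d m.
  by apply/funext => n; rewrite /matrix_term /= mulrDr mulrCA.
(* [limn] is known to be linear only on convergent series. *)
have cc := @is_cvg_matrix_term c m; have cd := @is_cvg_matrix_term d m.
exact: lim_series_linear cc cd.
Qed.

HB.instance Definition _ :=
  GRing.isLinear.Build R[i] (rdseq R) (rdseq R) _ rd_matrix_map
    rd_matrix_map_is_linear.

Lemma continuous_operator_polynomial_growth : continuous_operator A.
Proof.
split; first exact: is_cvg_matrix_term.
exists rd_matrix_map => //; apply: continuous_rdseq_linear => k.
have [L [D AD]] := weighted_matrix_map_le k.
by exists L, D => c; apply: rdnorm_le_ub => m; exact: AD.
Qed.

End PolynomialGrowth.

Unset Implicit Arguments.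

Theorem corollary3p3 (R : realType) (A : nat -> nat -> R[i])
  (hA : exists g0 C0 : R, [/\ 0 <= g0, 0 < C0 &
    forall g : R, 0 < g -> exists2 Cg : R, 0 < Cg &
      forall m n : nat,
        normc (A m n) <=
          (if (m < n)%N then C0 * n.+1%:R `^ g0
           else Cg * n.+1%:R `^ g * m.+1%:R `^ (- g))]) :
  continuous_operator A.
Proof.
have [g0 [C0 [g0_ge0 C0_gt0 AC]]] := hA.
apply: continuous_operator_polynomial_growth => k.
(* The exponent [k.+1], rather than [k], is positive even when [k = 0]. *)
have [Ck Ck_gt0 {}AC] := AC k.+1%:R (ltr0Sn _ _).
have [N g0N] : exists N, g0 <= N%:R.
  by exists (Num.bound g0); rewrite ltW// archi_boundP.
(* A common choice for both cases: n > m calls for n^(N+k) and [C0], n <= m for n^(k+1) and [Ck]. *)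
exists (N + k.+1)%N, (C0 + Ck) => m n.
have expr_ge1 j i : 1 <= j.+1%:R ^+ i :> R by rewrite exprn_ege1// ler1n.
apply: le_trans (ler_wpM2r (exprn_ge0 _ _) (AC m n)) _ => //.
case: ltnP => [mn|_].
  (* Case n > m: n^g0 <= n^N and m^k <= n^k <= n^(k+1). *)
  rewrite exprD -mulrA ler_pM ?mulr_ge0 ?powR_ge0 ?exprn_ge0 ?(ltW C0_gt0)//.
    by rewrite lerDl ltW.
  rewrite ler_pM ?powR_ge0 ?exprn_ge0//.
    by rewrite -powR_mulrn// ler_powR// ler1n.
  rewrite (@le_trans _ _ (n.+1%:R ^+ k))//.
    by rewrite lerXn2r ?nnegrE// ler_nat ltnW.
  by rewrite ler_weXn2l// ler1n.
rewrite powRN !powR_mulrn// -!mulrA.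
rewrite ler_pM ?mulr_ge0 ?invr_ge0 ?exprn_ge0 ?(ltW Ck_gt0)//.
  by rewrite lerDr ltW.
(* Case n <= m: once n^(k+1) is matched, m^k / m^(k+1) <= n^N remains, with left side at most 1 and
   right side at least 1. *)
rewrite exprD mulrC ler_pM ?mulr_ge0 ?invr_ge0 ?exprn_ge0//.
rewrite mulrC ler_pdivrMr ?exprn_gt0// (le_trans _ (ler_peMl _ _))//.
by rewrite ler_weXn2l// ler1n.
Qed.
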